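(* For every $\tau\in\prod_{p\in\mathbb P}\mathbb J_p$, the ring $R_\tau$ is a quasi-Euclidean domain. In particular, $R_\tau$ is a B\'ezout domain.
   Context: $\mathbb P$ is the set of all primes in $\mathbb N$. For $p\in\mathbb P$, $\mathbb J_p$ is the ring of $p$-adic integers, which contains $\mathbb Z$ canonically. For $k\ge 1$, $\pi_k:\mathbb J_p\to\mathbb Z/p^k\mathbb Z$ is the canonical projection, and $\pi_0:\mathbb J_p\to\{0\}$ is the zero map (the prime $p$ is suppressed in the notation). $\mathrm v_p$ is the usual $p$-adic valuation. For $\tau=(\tau_p)_{p\in\mathbb P}\in\prod_{p\in\mathbb P}\mathbb J_p$, define the subring of $\mathbb Q[x]$ $$R_\tau=\left\{\frac{h}{n}\in\mathbb Q[x]\ \Big|\ n\in\mathbb N\setminus\{0\},\ h\in\mathbb Z[x],\ \text{and } \pi_{\mathrm v_p(n)}(h(\tau_p))=0 \text{ for all } p\in\mathbb P\right\},$$ where $h(\tau_p)$ is evaluated in $\mathbb J_p$. A commutative domain $R$ is called quasi-Euclidean if there is a function $\phi:R^2\to\omega$ such that for all $(a,b)\in R^2$ with $b\neq 0$ there exists $q\in R$ with $\phi(b,a-bq)<\phi(a,b)$. *)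

(* Defs.v *)
From HB Require Import structures.
From mathcomp Require Import all_boot all_order all_algebra.
From mathcomp Require Import boolp.
Set Implicit Arguments.
Unset Strict Implicit.
Unset Printing Implicit Defensive.
Import GRing.Theory Num.Theory.
Local Open Scope ring_scope.

Definition primeNum := {p : nat | prime p}.
Definition nat_of_primeNum (p : primeNum) : nat := sval p.
Coercion nat_of_primeNum : primeNum >-> nat.

(* The p-adic integers as the inverse limit of the rings Z/p^k, k >= 0.       *)
(* Z/p^k is 'I_(p ^ k) with the modular operations Zp_add, Zp_mul; the type   *)
(* 'Z_(p ^ k) would be wrong at k = 0, where it is Z/2 and not {0}.           *)
Record padicInt (p : primeNum) := PadicInt {
  padic_proj : forall k : nat, 'I_(p ^ k);
  _ : forall k : nat, (padic_proj k.+1 %% p ^ k)%N = padic_proj k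
}.
Arguments padic_proj {p} x k : rename.

Section PadicRing.
Variable p : primeNum.
Implicit Types x y z : padicInt p.

Lemma expp_gt0 k : (0 < p ^ k)%N.
Proof. by rewrite expn_gt0 prime_gt0 //; case: p. Qed.

Lemma padic_modn x k : (padic_proj x k.+1 %% p ^ k)%N = padic_proj x k.
Proof. by case: x. Qed.

Lemma padic_eqP x y :
  (forall k, padic_proj x k = padic_proj y k :> nat) -> x = y.
Proof.
case: x => f Hf; case: y => g Hg /= fg.
have efg : f = g by apply: functional_extensionality_dep => k; apply/val_inj/fg.
by rewrite -efg in Hg *; congr PadicInt; apply: Prop_irrelevance.
Qed.

Lemma modn_expS m k : ((m %% p ^ k.+1) %% p ^ k = m %% p ^ k)%N.
Proof. by rewrite modn_dvdm // expnS dvdn_mull. Qed.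

Lemma padic_nat_subproof n k :
  ((Ordinal (ltn_pmod n (expp_gt0 k.+1)) : nat) %% p ^ k)%N
    = Ordinal (ltn_pmod n (expp_gt0 k)).
Proof. exact: modn_expS. Qed.
Definition padic_nat n : padicInt p := PadicInt (padic_nat_subproof n).

Lemma padic_add_subproof x y k :
  (Zp_add (padic_proj x k.+1) (padic_proj y k.+1) %% p ^ k)%N
    = Zp_add (padic_proj x k) (padic_proj y k).
Proof. by rewrite /= modn_expS -modnDm !padic_modn. Qed.
Definition padic_add x y := PadicInt (padic_add_subproof x y).

Lemma padic_mul_subproof x y k :
  (Zp_mul (padic_proj x k.+1) (padic_proj y k.+1) %% p ^ k)%N
    = Zp_mul (padic_proj x k) (padic_proj y k).
Proof. by rewrite /= modn_expS -modnMm !padic_modn. Qed.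
Definition padic_mul x y := PadicInt (padic_mul_subproof x y).

Lemma padic_opp_subproof x k :
  (Zp_opp (padic_proj x k.+1) %% p ^ k)%N = Zp_opp (padic_proj x k).
Proof.
rewrite /= modn_expS -(padic_modn x k).
set a := nat_of_ord _; have lea : (a <= p ^ k.+1)%N by apply/ltnW/ltn_ord.
set b := (a %% _)%N; have leb : (b <= p ^ k)%N by apply/ltnW/ltn_pmod/expp_gt0.
apply/eqP; rewrite -(eqn_modDr a) subnK // -modnDmr -/b subnK // modnn.
by rewrite expnS modnMl.
Qed.
Definition padic_opp x := PadicInt (padic_opp_subproof x).

HB.instance Definition _ := gen_eqMixin (padicInt p).
HB.instance Definition _ := gen_choiceMixin (padicInt p).

Fact padic_addA : associative padic_add.
Proof. by move=> x y z; apply: padic_eqP => k; rewrite [LHS](congr1 _ (Zp_addA _ _ _)). Qed.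
Fact padic_addC : commutative padic_add.
Proof. by move=> x y; apply: padic_eqP => k; rewrite /= addnC. Qed.
Fact padic_add0 : left_id (padic_nat 0) padic_add.
Proof.
by move=> x; apply: padic_eqP => k; rewrite /= mod0n add0n modn_small.
Qed.
Fact padic_addN : left_inverse (padic_nat 0) padic_opp padic_add.
Proof.
move=> x; apply: padic_eqP => k /=.
by rewrite modnDml subnK ?modnn ?mod0n // ltnW.
Qed.
HB.instance Definition _ := GRing.isZmodule.Build (padicInt p)
  padic_addA padic_addC padic_add0 padic_addN.

Fact padic_mulA : associative padic_mul.
Proof. by move=> x y z; apply: padic_eqP => k; rewrite [LHS](congr1 _ (Zp_mulA _ _ _)). Qed.
Fact padic_mulC : commutative padic_mul.
Proof. by move=> x y; apply: padic_eqP => k; rewrite /= mulnC. Qed.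
Fact padic_mul1 : left_id (padic_nat 1) padic_mul.
Proof.
by move=> x; apply: padic_eqP => k; rewrite /= modnMml mul1n modn_small.
Qed.
Fact padic_mulD : left_distributive padic_mul padic_add.
Proof. by move=> x y z; apply: padic_eqP => k; rewrite [LHS](congr1 _ (Zp_mul_addl _ _ _)). Qed.
Fact padic_one_neq0 : padic_nat 1 != padic_nat 0.
Proof.
apply/eqP => /(congr1 (fun x => padic_proj x 1 : nat)) /=.
by rewrite mod0n modn_small // expn1 prime_gt1 //; case: (p).
Qed.
HB.instance Definition _ := GRing.Zmodule_isComNzRing.Build (padicInt p)
  padic_mulA padic_mulC padic_mul1 padic_mulD padic_one_neq0.

Lemma padic_projD x y k :
  padic_proj (x + y) k = Zp_add (padic_proj x k) (padic_proj y k).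
Proof. by []. Qed.
Lemma padic_projM x y k :
  padic_proj (x * y) k = Zp_mul (padic_proj x k) (padic_proj y k).
Proof. by []. Qed.
Lemma padic_projN x k : padic_proj (- x) k = Zp_opp (padic_proj x k).
Proof. by []. Qed.

Lemma padic_proj_nat n k : padic_proj (n%:R : padicInt p) k = (n %% p ^ k)%N :> nat.
Proof.
elim: n => [|n IHn] //.
by rewrite -addn1 natrD padic_projD /= IHn modnDml modnDmr.
Qed.

Lemma padic_modnD x k l : (padic_proj x (k + l) %% p ^ k)%N = padic_proj x k.
Proof.
elim: l => [|l IHl]; first by rewrite addn0 modn_small.
rewrite addnS -IHl -(padic_modn x (k + l)) modn_dvdm //.
by rewrite expnD dvdn_mulr.
Qed.

Lemma padic_proj_eq0 x k l :
  padic_proj x k = 0%N :> nat -> (p ^ k %| padic_proj x (k + l))%N.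
Proof. by move=> x0; rewrite /dvdn padic_modnD x0. Qed.

Lemma padic_proj_mul0 x y k l :
  padic_proj x k = 0%N :> nat -> padic_proj y l = 0%N :> nat ->
  padic_proj (x * y) (k + l) = 0%N :> nat.
Proof.
move=> x0 y0; rewrite padic_projM /=; apply/eqP.
have xk := padic_proj_eq0 l x0; have yl := padic_proj_eq0 k y0.
rewrite [(l + k)%N]addnC in yl.
by have := dvdn_mul xk yl; rewrite -expnD.
Qed.

Lemma padic_proj_sub0 x y k :
  padic_proj x k = 0%N :> nat -> padic_proj y k = 0%N :> nat ->
  padic_proj (x - y) k = 0%N :> nat.
Proof.
by move=> x0 y0; rewrite padic_projD padic_projN /= x0 y0 subn0 modnn mod0n.
Qed.

End PadicRing.

Definition in_Rtau (tau : forall p : primeNum, padicInt p) (g : {poly rat}) : Prop :=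
  exists (n : nat) (h : {poly int}),
    [/\ (0 < n)%N,
        g = (n%:R)^-1 *: map_poly intr h &
        forall p : primeNum,
          padic_proj (map_poly intr h).[tau p] (logn p n) = 0%N :> nat].

Definition Rtau_pred (tau : forall p : primeNum, padicInt p) : {pred {poly rat}} :=
  fun g => `[< in_Rtau tau g >].

Section RtauRing.
Variable tau : forall p : primeNum, padicInt p.

Lemma RtauP g : reflect (in_Rtau tau g) (g \in Rtau_pred tau).
Proof. exact: asboolP. Qed.

Fact Rtau_subring : subring_closed (Rtau_pred tau).
Proof.
have natnz n : (0 < n)%N -> n%:R != 0 :> rat by rewrite pnatr_eq0 -lt0n.
split.
- apply/RtauP; exists 1%N, 1; split=> //.
    by rewrite invr1 scale1r [RHS]rmorph1.
  by move=> p; rewrite logn1; case: (padic_proj _ _) => -[|m].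
- move=> f g /RtauP[n [h [n0 -> nh]]] /RtauP[m [k [m0 -> mk]]]; apply/RtauP.
  exists (n * m)%N, (m%:R *: h - n%:R *: k); split.
  + by rewrite muln_gt0 n0.
  + rewrite rmorphB /= !map_polyZ /= !rmorph_nat scalerBr !scalerA natrM invfM.
    by rewrite mulfVK ?natnz // [_^-1 * _]mulrC mulfVK ?natnz.
  + move=> p; rewrite rmorphB /= !map_polyZ /= !rmorph_nat hornerD hornerN !hornerZ.
    rewrite lognM //; apply: padic_proj_sub0.
      rewrite addnC; apply: padic_proj_mul0 => //.
      by rewrite padic_proj_nat; apply/eqP/pfactor_dvdnn.
    apply: padic_proj_mul0 => //.
    by rewrite padic_proj_nat; apply/eqP/pfactor_dvdnn.
- move=> f g /RtauP[n [h [n0 -> nh]]] /RtauP[m [k [m0 -> mk]]]; apply/RtauP.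
  exists (n * m)%N, (h * k); split.
  + by rewrite muln_gt0 n0.
  + by rewrite -scalerAl -scalerAr scalerA natrM invfM rmorphM.
  + by move=> p; rewrite rmorphM hornerM lognM //; apply: padic_proj_mul0.
Qed.

HB.instance Definition _ :=
  GRing.isSubringClosed.Build {poly rat} (Rtau_pred tau) Rtau_subring.

Record Rtau := MkRtau { Rtau_val :> {poly rat}; _ : Rtau_val \in Rtau_pred tau }.

HB.instance Definition _ := [isSub for Rtau_val].
HB.instance Definition _ := [Choice of Rtau by <:].
HB.instance Definition _ := [SubChoice_isSubComNzRing of Rtau by <:].

End RtauRing.

Definition quasi_Euclidean_domain (R : comNzRingType) : Prop :=
  GRing.integral_domain_axiom R /\
  exists phi : R * R -> nat, forall a b : R, b != 0 ->
    exists q : R, (phi (b, (a - b * q)%R) < phi (a, b))%N.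

Definition generated_ideal (R : comNzRingType) (n : nat) (a : 'I_n -> R) (x : R) : Prop :=
  exists c : 'I_n -> R, x = \sum_(i < n) c i * a i.

Definition principal_ideal (R : comNzRingType) (d x : R) : Prop :=
  exists c : R, x = c * d.

Definition Bezout_domain (R : comNzRingType) : Prop :=
  GRing.integral_domain_axiom R /\
  forall (n : nat) (a : 'I_n -> R), exists d : R,
    forall x : R, generated_ideal a x <-> principal_ideal d x.

(* Main.v *)
Require Import Defs.
From HB Require Import structures.
From mathcomp Require Import all_boot all_order all_algebra.
From mathcomp Require Import boolp ring.

(** Write f(tau_p) for the value in Q_p of a polynomial f over Q.  The ring
    [Rtau tau] consists of the f such that f(tau_p) is a p-adic integer for
    every prime p.

    A ring is quasi-Euclidean as soon as every pair (a, b) has a division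
    chain, that is, iterating (a, b) |-> (b, a - b q) with well chosen
    quotients reaches a pair (d, 0): the least length of such a chain is the
    required function ([quasi_Euclidean_of_chains]).  So the point is to run a
    Euclidean algorithm in [Rtau tau], and it has two kinds of steps.

    If deg b < deg a, the leading term of a can be cancelled.  The quotient
    must have degree k >= 1 and leading coefficient an arbitrary rational c,
    and [Rtau tau] contains such a polynomial ([Rtau_lead_coef]): if n is the
    denominator of c, the Chinese remainder theorem gives a natural number m
    congruent to tau_p modulo p ^ v_p(n) for all p, and then
    c x^(k-1) (x - m) belongs to [Rtau tau].

    If deg a = deg b, quotients are taken in Z and the ordinary Euclidean
    algorithm is applied to the two leading coefficients, multiplied by a
    common denominator.  It stops when one of them becomes 0, which means that
    a degree has dropped ([has_chain_eq_size]).

    Hence the sum of the degrees goes down until one entry of the pair is 0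
    ([Rtau_has_chain]).  The Bezout property follows in any quasi-Euclidean
    domain, because the ideal (a, b) does not change along a division chain. *)

Set Implicit Arguments.
Unset Strict Implicit.
Unset Printing Implicit Defensive.
Import GRing.Theory Num.Theory.
Local Open Scope ring_scope.

(** * Division chains and quasi-Euclidean rings *)

Section DivisionChains.
Variable R : comNzRingType.
Implicit Types a b q : R.

Fixpoint div_chain (n : nat) a b : Prop :=
  if n is n'.+1 then exists q, div_chain n' b (a - b * q) else b = 0.

Definition has_chain a b : Prop := exists n, div_chain n a b.

Lemma has_chain0 a : has_chain a 0.
Proof. by exists 0%N. Qed.

Lemma has_chain_step a b q : has_chain b (a - b * q) -> has_chain a b.
Proof. by case=> n ch; exists n.+1, q. Qed.

Lemma has_chain_swap a b : has_chain b a -> has_chain a b.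
Proof. by move=> ch; apply: (@has_chain_step _ _ 0); rewrite mulr0 subr0. Qed.

(** The first quotient of a shortest chain leaves a pair with a chain that is
    shorter by one, so the least length is a quasi-Euclidean function. *)
Lemma quasi_Euclidean_of_chains :
  GRing.integral_domain_axiom R -> (forall a b, has_chain a b) ->
  quasi_Euclidean_domain R.
Proof.
move=> domR chR; split=> //.
have chb (ab : R * R) : exists n, `[< div_chain n ab.1 ab.2 >].
  by have [n ch] := chR ab.1 ab.2; exists n; apply/asboolP.
exists (fun ab => ex_minn (chb ab)) => a b b_neq0.
case: (ex_minnP (chb (a, b))) => -[|n] /asboolP /= ch _.
  by rewrite ch eqxx in b_neq0.
have [q chq] := ch; exists q.
by case: ex_minnP => m _ /(_ n); apply; apply/asboolP.
Qed.

(** Since a = (a - b q) + q b, the pairs (a, b) and (b, a - b q) generate the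
    same ideal; the induction follows the decrease of the quasi-Euclidean
    function. *)
Lemma quasi_Euclidean_pair_principal a b : quasi_Euclidean_domain R ->
  exists d, forall x, (exists u v, x = u * a + v * b) <-> principal_ideal d x.
Proof.
case=> _ [phi phiP]; have [N] := ubnP (phi (a, b)).
elim: N a b => // N IHN a b ltN.
have [-> | b_neq0] := eqVneq b 0.
  exists a => x; split=> [[u [v ->]] | [c ->]].
    by exists u; rewrite mulr0 addr0.
  by exists c, 0; rewrite mul0r addr0.
have [q ltq] := phiP a b b_neq0.
have [d dP] := IHN b (a - b * q) (leq_trans ltq ltN).
exists d => x; rewrite -dP; split=> [[u [v ->]] | [u [v ->]]].
  by exists (v + u * q), u; ring.
by exists v, (u - v * q); ring.
Qed.

Lemma quasi_Euclidean_Bezout : quasi_Euclidean_domain R -> Bezout_domain R.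
Proof.
move=> qeR; split=> [|n]; first by case: qeR.
elim: n => [|n IHn] a.
  exists 0 => x; split=> [[c ->] | [c ->]].
    by exists 0; rewrite big_ord0 mulr0.
  by exists (fun=> 0); rewrite big_ord0 mulr0.
have [e eP] := IHn (fun i => a (lift ord0 i)).
have [d dP] := quasi_Euclidean_pair_principal (a ord0) e qeR.
exists d => x; rewrite -dP; split=> [[c ->] | [u [v ->]]].
  rewrite big_ord_recl.
  have /eP[v ->] : generated_ideal (fun i => a (lift ord0 i))
      (\sum_(i < n) c (lift ord0 i) * a (lift ord0 i)).
    by exists (fun i => c (lift ord0 i)).
  by exists (c ord0), v.
have /eP[c ->] : principal_ideal e (v * e) by exists v.
exists (fun i => if unlift ord0 i is Some j then c j else u).
rewrite big_ord_recl unlift_none; congr (_ + _).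
by apply: eq_bigr => i _; rewrite liftK.
Qed.

End DivisionChains.

(** * Simultaneous congruences *)

Lemma chinese_remainder_seq (I : eqType) (M r : I -> nat) (s : seq I) :
    uniq s -> {in s &, forall i j, i != j -> coprime (M i) (M j)} ->
  exists m, {in s, forall i, m = r i %[mod M i]}.
Proof.
elim: s => [|i s IHs] /=; first by exists 0%N.
case/andP=> i_notin s_uniq coM.
have [|m mP] := IHs s_uniq.
  by move=> j k js ks; apply: coM; rewrite inE ?js ?ks orbT.
pose P := (\prod_(j <- s) M j)%N.
have coP : coprime (M i) P.
  rewrite /P big_seq; apply: (big_ind (fun k => coprime (M i) k)).
  - exact: coprimen1.
  - by move=> k l cok col; rewrite coprimeMr cok.
  move=> j js; apply: coM; rewrite ?inE ?eqxx ?js ?orbT //.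
  by apply: contraNneq i_notin => ->.
exists (chinese (M i) P (r i) m) => j; rewrite inE => /predU1P[-> | js].
  exact: chinese_modl.
have MjP : (M j %| P)%N by rewrite /P (big_rem j) //= dvdn_mulr.
by rewrite -mP // -(modn_dvdm _ MjP) chinese_modr // modn_dvdm.
Qed.

Lemma padic_proj_subn_eq0 (p : primeNum) (x : padicInt p) (m k : nat) :
  m = padic_proj x k %[mod p ^ k] -> padic_proj (x - m%:R) k = 0%N :> nat.
Proof.
move=> mx; rewrite padic_projD padic_projN /= padic_proj_nat mx.
by rewrite (modn_small (ltn_ord _)) modnDmr subnKC ?modnn // ltnW.
Qed.

(** Only the finitely many prime divisors of n impose a condition. *)
Lemma padic_approx (tau : forall p : primeNum, padicInt p) (n : nat) :
  exists m : nat, forall p : primeNum,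
    padic_proj (tau p - m%:R) (logn p n) = 0%N :> nat.
Proof.
pose s : seq primeNum := pmap insub (primes n).
pose M (p : primeNum) : nat := (p ^ logn p n)%N.
pose r (p : primeNum) : nat := padic_proj (tau p) (logn p n).
have [||m mP] := @chinese_remainder_seq _ M r s.
- exact/pmap_sub_uniq/primes_uniq.
- move=> p q _ _ pq; apply/coprimeXl/coprimeXr.
  by rewrite prime_coprime ?(valP p) // dvdn_prime2 ?(valP p) ?(valP q).
exists m => p; have [p_n | p_n] := boolP (nat_of_primeNum p \in primes n).
  by apply: padic_proj_subn_eq0; apply: mP; rewrite mem_pmap_sub.
have -> : logn p n = 0%N by apply/eqP; rewrite -leqn0 leqNgt logn_gt0.
by case: (padic_proj _ _) => -[].
Qed.

(** * The Euclidean algorithm in Rtau *)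

Lemma size_le_coef0 (A : nzRingType) (f : {poly A}) (s : nat) :
  (size f <= s.+1)%N -> f`_s = 0 -> (size f <= s)%N.
Proof.
move=> /leq_sizeP f_le fs; apply/leq_sizeP => j.
by rewrite leq_eqVlt => /predU1P[<- // | /f_le].
Qed.

Section EuclideanAlgorithm.
Variable tau : forall p : primeNum, padicInt p.
Implicit Types a b q : Rtau tau.

Lemma Rtau_valBM a b q :
  Rtau_val (a - b * q) = Rtau_val a - Rtau_val b * Rtau_val q.
Proof. by []. Qed.

Lemma Rtau_val_int (z : int) : Rtau_val (z%:~R : Rtau tau) = z%:~R.
Proof. exact: (rmorph_int (val : Rtau tau -> {poly rat})). Qed.

Lemma Rtau_val_eq0 a : (Rtau_val a == 0) = (a == 0).
Proof. by rewrite -(inj_eq val_inj). Qed.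

Lemma Rtau_domain : GRing.integral_domain_axiom (Rtau tau).
Proof.
move=> a b ab0; rewrite -!Rtau_val_eq0 -mulf_eq0.
by have /(congr1 (@Rtau_val tau)) /= -> := ab0.
Qed.

(** In positive degree every rational is a leading coefficient, although the
    constants of [Rtau tau] are the integers: the factor x - m, with m close to
    every tau_p, makes up for the denominator. *)
Lemma Rtau_lead_coef (c : rat) (k : nat) : c != 0 ->
  exists q, size (Rtau_val q) = k.+2 /\ lead_coef (Rtau_val q) = c.
Proof.
move=> c_neq0; pose n := `|denq c|%N.
have nE : n%:R = (denq c)%:~R :> rat by rewrite -[in RHS]absz_denq.
have n_neq0 : n%:R != 0 :> rat by rewrite nE intr_eq0 denq_neq0.
have [m mP] := padic_approx tau n.
pose g : {poly int} := 'X^k * ('X - (m%:R)%:P).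
have g_monic : g \is monic by rewrite monicMl ?monicXn ?monicXsubC.
have g_size : size g = k.+2.
  by rewrite size_Mmonic ?monicXsubC ?monic_neq0 ?monicXn // size_polyXn
             size_XsubC addn2.
pose h := numq c *: g.
pose f : {poly rat} := n%:R^-1 *: map_poly intr h.
have f_in : f \in Rtau_pred tau.
  apply/RtauP; exists n, h; split=> // [|p]; first by rewrite absz_gt0 denq_neq0.
  have -> : (map_poly intr h).[tau p] =
      ((numq c)%:~R * tau p ^+ k) * (tau p - m%:R).
    rewrite map_polyZ hornerZ rmorphM hornerM /= map_polyXn hornerXn.
    by rewrite rmorphB /= map_polyX map_polyC /= rmorph_nat hornerXsubC mulrA.
  rewrite -[logn p n]add0n; apply: padic_proj_mul0 => //.
  by case: (padic_proj _ _) => -[].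
exists (MkRtau f_in); split=> /=.
  rewrite size_scale ?invr_eq0 // size_map_inj_poly //; last exact: intr_inj.
  by rewrite size_scale ?numq_eq0.
rewrite lead_coefZ lead_coef_map_inj //; last exact: intr_inj.
by rewrite lead_coefZ (monicP g_monic) mulr1 nE mulrC divq_num_den.
Qed.

Lemma Rtau_reduce_size a b : b != 0 ->
    (size (Rtau_val b) < size (Rtau_val a))%N ->
  exists q, (size (Rtau_val (a - b * q)%R) < size (Rtau_val a))%N.
Proof.
rewrite -Rtau_val_eq0 => b_neq0 lt_ba.
have a_neq0 : Rtau_val a != 0 by rewrite -size_poly_gt0 (leq_trans _ lt_ba).
pose c := lead_coef (Rtau_val a) / lead_coef (Rtau_val b).
have lb_neq0 : lead_coef (Rtau_val b) != 0 by rewrite lead_coef_eq0.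
have c_neq0 : c != 0 by rewrite mulf_neq0 ?invr_eq0 ?lead_coef_eq0.
have [q [q_size q_lead]] :=
  Rtau_lead_coef (size (Rtau_val a) - size (Rtau_val b)).-1 c_neq0.
have q_neq0 : Rtau_val q != 0 by rewrite -size_poly_gt0 q_size.
have bq_size : size (Rtau_val b * Rtau_val q) = size (Rtau_val a).
  by rewrite size_mul // q_size prednK ?subn_gt0 // addnS /= subnKC // ltnW.
exists q; rewrite Rtau_valBM -(ltn_predK lt_ba) ltnS.
apply: size_le_coef0.
  rewrite (ltn_predK lt_ba) (leq_trans (size_polyD _ _)) //.
  by rewrite size_polyN bq_size maxnn.
rewrite coefB -{2}bq_size -!lead_coefE lead_coefM q_lead /c.
by rewrite mulrC divfK // subrr.
Qed.

(** The integers u and w are the leading coefficients of a and b multiplied by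
    a common denominator D, and the induction is that of Euclid's algorithm for
    (u, w). *)
Lemma has_chain_eq_size (s : nat) :
    (forall a b, (size (Rtau_val a) + size (Rtau_val b) <= s + s.+1)%N ->
       has_chain a b) ->
  forall (D : rat) (u w : int) a b, D != 0 ->
    size (Rtau_val a) = s.+1 -> size (Rtau_val b) = s.+1 ->
    (Rtau_val a)`_s * D = u%:~R -> (Rtau_val b)`_s * D = w%:~R ->
  has_chain a b.
Proof.
move=> IHs D u w a b D_neq0; have [N] := ubnP `|w|%N.
elim: N u w a b => // N IHN u w a b ltN sa sb au bw.
have w_neq0 : w != 0.
  rewrite -(intr_eq0 rat) -bw mulf_neq0 //.
  have -> : (Rtau_val b)`_s = lead_coef (Rtau_val b) by rewrite lead_coefE sb.
  by rewrite lead_coef_eq0 -size_poly_gt0 sb.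
pose q := (u %/ w)%Z; pose r := Rtau_val (a - b * q%:~R).
have rE : r = Rtau_val a - q%:~R *: Rtau_val b.
  by rewrite /r Rtau_valBM Rtau_val_int scaler_int mulrzr.
have r_le : (size r <= s.+1)%N.
  rewrite rE (leq_trans (size_polyD _ _)) // geq_max sa leqnn size_polyN.
  by rewrite -sb size_scale_leq.
have r_coef : r`_s * D = (u %% w)%Z%:~R.
  by rewrite rE coefB coefZ mulrBl -mulrA bw au -intrM -intrB.
apply: (@has_chain_step _ _ _ q%:~R).
have [uw0 | uw_neq0] := eqVneq (u %% w)%Z 0.
  apply: IHs; rewrite sb addnC leq_add2r.
  apply: size_le_coef0 => //; apply/eqP.
  by rewrite -(mulIr_eq0 _ (mulIf D_neq0)) r_coef uw0.
apply: (IHN w (u %% w)%Z) => //.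
  rewrite (leq_trans _ (ltN : (`|w| <= N)%N)) // -ltz_nat.
  by rewrite gez0_abs ?modz_ge0 // abszE ltz_mod.
apply/eqP; rewrite eqn_leq r_le /= ltnNge; apply: contraNN uw_neq0 => r_small.
by rewrite -(intr_eq0 rat) -r_coef (nth_default _ r_small) mul0r.
Qed.

Lemma Rtau_has_chain a b : has_chain a b.
Proof.
have [N] := ubnP (size (Rtau_val a) + size (Rtau_val b)).
elim: N a b => // N IHN a b ltN.
have reduce (x y : Rtau tau) : (size (Rtau_val x) + size (Rtau_val y) < N.+1)%N ->
    (size (Rtau_val y) < size (Rtau_val x))%N -> has_chain x y.
  move=> ltxyN lt_yx; have [-> | y_neq0] := eqVneq y 0; first exact: has_chain0.
  have [q lt_q] := Rtau_reduce_size y_neq0 lt_yx.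
  apply: (has_chain_step (q := q)); apply: IHN.
  by rewrite addnC (leq_trans _ (ltxyN : (_ <= N)%N)) // ltn_add2r.
have [lt_ab | lt_ba | eq_ab] := ltngtP (size (Rtau_val a)) (size (Rtau_val b)).
- by apply/has_chain_swap/reduce; rewrite // addnC.
- exact: reduce.
have [-> | b_neq0] := eqVneq b 0; first exact: has_chain0.
case sb: (size (Rtau_val b)) => [|s].
  by move: sb b_neq0; rewrite -Rtau_val_eq0 -size_poly_eq0 => ->.
have sa : size (Rtau_val a) = s.+1 by rewrite eq_ab.
set ca := (Rtau_val a)`_s; set cb := (Rtau_val b)`_s.
have denK (c : rat) : c * (denq c)%:~R = (numq c)%:~R by rewrite numqE.
apply: (@has_chain_eq_size s _ ((denq ca)%:~R * (denq cb)%:~R)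
  (numq ca * denq cb) (numq cb * denq ca)) => //.
- move=> x y le_xy; apply: IHN; rewrite (leq_ltn_trans le_xy) //.
  by move: ltN; rewrite sa sb addSn.
- by rewrite mulf_neq0 // intr_eq0 denq_neq0.
- by rewrite mulrA denK -intrM.
- by rewrite mulrCA denK -intrM mulrC.
Qed.

End EuclideanAlgorithm.

Theorem theorem3p2 (tau : forall p : primeNum, padicInt p) :
  quasi_Euclidean_domain (Rtau tau) /\ Bezout_domain (Rtau tau).
Proof.
have qe : quasi_Euclidean_domain (Rtau tau).
  exact: quasi_Euclidean_of_chains (@Rtau_domain tau) (@Rtau_has_chain tau).
by split=> //; apply: quasi_Euclidean_Bezout.
Qed.
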